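(* Let $a>0$, $\phi_a(x)=e^{-ax^2}$, and let $f=\sum_{k\in\mathbb{Z}}c_k\phi_a(\cdot-k)$ with $c\in\ell^\infty(\mathbb{Z})$, $f\not\equiv0$. Let $N_f$ be its set of real zeros, with multiplicities $m_f(x)$, $x\in N_f$. Then $D^-(N_f,m_f)\le1$.
   Context: The multiplicity $m_f(x)$ of a real zero $x$ is the order of vanishing of $f$ at $x$, i.e. the largest $m$ with $f^{(j)}(x)=0$ for $0\le j<m$. $D^-(N,m)=\liminf_{r\to\infty}\inf_{x\in\mathbb{R}}\frac{1}{2r}\sum_{\lambda\in N\cap[x-r,x+r]}m(\lambda)$. *)

(* Defs.v *)
From HB Require Import structures.
From mathcomp Require Import all_boot all_order all_algebra.
From mathcomp Require Import all_classical all_reals all_analysis.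
From mathcomp Require Import complex.
Set Implicit Arguments. Unset Strict Implicit. Unset Printing Implicit Defensive.
Import Order.TTheory GRing.Theory Num.Theory numFieldNormedType.Exports.
Local Open Scope classical_set_scope.
Local Open Scope ring_scope.

Section Defs.
Variable R : realType.

Definition gauss (a x : R) : R := expR (- (a * x ^+ 2)).

Definition gpsum (a : R) (d : int -> R) (x : R) (n : nat) : R :=
  \sum_(0 <= i < (2 * n).+1) d (i%:Z - n%:Z) * gauss a (x - (i%:Z - n%:Z)%:~R).

Definition fRe (a : R) (c : int -> R[i]) (x : R) : R :=
  limn (gpsum a (fun k => complex.Re (c k)) x).
Definition fIm (a : R) (c : int -> R[i]) (x : R) : R :=
  limn (gpsum a (fun k => complex.Im (c k)) x).

Definition zeroset (a : R) (c : int -> R[i]) : set R :=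
  [set x | fRe a c x = 0 /\ fIm a c x = 0].

(* m_f(x): largest m with f^(j)(x) = 0 for all j < m
   (f^(j) = (Re f)^(j) + i (Im f)^(j)); valued in \bar R (+oo if no largest) *)
Definition mult (a : R) (c : int -> R[i]) (x : R) : \bar R :=
  ereal_sup [set (m%:R)%:E | m in
    [set m : nat | forall j : nat, (j < m)%N ->
        derive1n j (fRe a c) x = 0 /\ derive1n j (fIm a c) x = 0]].

(* D^-(N,m) = liminf_{r->oo} inf_x (1/2r) sum_{lambda in N cap [x-r,x+r]} m(lambda) *)
Definition lower_density (N : set R) (m : R -> \bar R) : \bar R :=
  ereal_sup [set ereal_inf [set
      ereal_inf [set (((2 * r)^-1)%:E *
                     \esum_(l in N `&` [set l : R | (x - r <= l <= x + r)%R]) m l)%E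
                 | x in [set: R]]
      | r in [set r | r0 <= r]] | r0 in [set: R]].

End Defs.

(* Main.v *)
Require Import Defs.
From HB Require Import structures.
From mathcomp Require Import all_boot all_order all_algebra.
From mathcomp Require Import all_classical all_reals all_analysis.
From mathcomp Require Import complex.
From mathcomp Require Import ring lra zify.
Import Order.TTheory GRing.Theory Num.Theory numFieldNormedType.Exports.
Local Open Scope classical_set_scope.
Local Open Scope ring_scope.

(** Write [f x = exp (- a x^2) * L (exp (2 a x))], where [L] is the Laurent
    series with coefficients [b k = c k * exp (- a k^2)].  A real zero of [f],
    counted with multiplicity, is a positive zero [l] of [L], and dividing [L]
    by [z - l] gives a series [h] with [b k = h (k - 1) - l * h k].  For the
    norms [|b|_r = sup_k |b k| r^k] this recurrence yields
    [|r - l| |h|_r <= |b|_r] and [|b|_1 <= (1 + l) |h|_1], while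
    [|h|_1^2 <= |h|_r |h|_(1/r)].  Dividing out all zeros in [[-n, n]] with
    [r = exp (2 a n + 6)], and using that [c] is bounded, one gets the
    Jensen-type inequality [\sum_x (n - |x|) <= (n + 3 / a)^2 + K], the sum
    being over these zeros.  A lower density [D > 1] would make the left-hand
    side at least [D n^2 - O(n)].  If [c] is complex, it is enough to apply this
    to whichever of [Re f] and [Im f] is not identically zero. *)

Set Implicit Arguments.
Unset Strict Implicit.

(** * Entire power series, Laurent series, and division of the latter by a linear factor *)

Section EntireSeries.
Context {R : realType}.
Implicit Types (c : nat -> R) (b h : int -> R).

(** Infinite radius of convergence, put as boundedness because the later estimates all concern
    weighted coefficients. *)
Definition entire c :=
  forall r : R, 0 < r -> exists C, forall n, `|c n| * r ^+ n <= C.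

Definition psum c (x : R) : R := limn (pseries c x).

Lemma entire_ge c (r0 : R) : 0 < r0 ->
  (forall r : R, r0 <= r -> exists C, forall n, `|c n| * r ^+ n <= C) ->
  entire c.
Proof.
move=> r00 H r rpos; have [C HC] := H (Num.max r0 r) ltac:(by rewrite le_max lexx).
exists C => n; apply: le_trans (HC n); apply: ler_wpM2l => //.
by rewrite lerXn2r ?nnegrE ?le_max ?lexx ?orbT ?(ltW rpos) ?(ltW r00).
Qed.

Lemma entire_shift c m : entire c -> entire (fun n => c (m + n)%N).
Proof.
move=> ec r r0; have [C HC] := ec _ r0; exists (C / r ^+ m) => n.
rewrite ler_pdivlMr ?exprn_gt0// -mulrA -exprD addnC; exact: HC.
Qed.

Lemma entire_diffs c : entire c -> entire (pseries_diffs c).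
Proof.
move=> ec r r0; have [C HC] := ec (2 * r) ltac:(lra).
exists (C / r) => n; rewrite ler_pdivlMr// /pseries_diffs.
apply: le_trans (HC n.+1).
rewrite normrM -mulrA -exprSr mulrAC mulrC; apply: ler_wpM2l => //.
rewrite exprMn; apply: ler_wpM2r; first by rewrite exprn_ge0// ltW.
by rewrite normr_nat -natrX ler_nat; exact: ltnW (ltn_expl _ _).
Qed.

(** Doubling the radius makes the terms at [x] at most [C / 2 ^ n], and these sum to [2 * C]. *)
Lemma psum_bound_cvg c (x C : R) : x != 0 ->
  (forall n, `|c n| * (2 * `|x|) ^+ n <= C) ->
  cvgn (pseries c x) /\ `|psum c x| <= 2 * C.
Proof.
move=> x0 HC; have xp : 0 < `|x| by rewrite normr_gt0.
have C0 : 0 <= C by apply: le_trans (HC 0%N); rewrite mulr_ge0// exprn_ge0// mulr_ge0.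
have le1 n : `|c n * x ^+ n| <= geometric C 2^-1 n.
  rewrite /= normrM normrX exprVn ler_pdivlMr ?exprn_gt0//.
  by rewrite -mulrA -exprMn mulrC [_ * 2]mulrC mulrC; exact: HC.
have half : `|2^-1 : R| < 1 by rewrite ger0_norm; lra.
have cg := @cvg_geometric_series _ C _ half.
have cn : cvgn [normed pseries c x].
  apply: (series_le_cvg _ _ le1); [by move=> n/=|move=> n; exact: geometric_ge0|].
  exact: is_cvg_geometric_series.
have cc : cvgn (pseries c x) by exact: normed_cvg.
split=> //; apply: (le_trans (lim_series_norm cn)).
apply: (le_trans (lim_series_le cn (cvgP _ cg) le1)).
rewrite (cvg_lim _ cg)// (_ : 1 - 2^-1 = 2^-1 :> R); last lra.
by rewrite invrK mulrC.
Qed.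

Lemma is_cvg_psum c (x : R) : entire c -> cvgn (pseries c x).
Proof.
move=> ec; have [->|x0] := eqVneq x 0.
  have [C HC] := ec 2 ltac:(lra).
  have [|H _] := @psum_bound_cvg c 1 C (oner_neq0 _).
    by move=> n; rewrite normr1 mulr1.
  by apply: (is_cvg_pseries_inside H); rewrite normr0 normr1.
have [C HC] := ec (2 * `|x|) ltac:(by rewrite mulr_gt0 ?normr_gt0).
by have [] := psum_bound_cvg x0 HC.
Qed.

Lemma psum_recl c (x : R) : entire c ->
  psum c x = c 0%N + x * psum (fun n => c n.+1) x.
Proof.
move=> ec; have e1 := entire_shift 1 ec.
apply/cvg_lim => //; rewrite -cvg_shiftS.
have -> : [sequence pseries c x n.+1]_n =
    (fun n => c 0%N + x * pseries (fun n => c n.+1) x n).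
  apply/funext => n; rewrite /pseries /series /= big_nat_recl//= expr0 mulr1.
  congr (_ + _); rewrite mulr_sumr; apply: eq_bigr => i _.
  by rewrite exprS mulrCA.
by apply: cvgD; [exact: cvg_cst|apply: cvgMr; exact: is_cvg_psum e1].
Qed.

Lemma psum_is_derive c (x : R) : entire c ->
  is_derive x 1 (psum c) (psum (pseries_diffs c) x).
Proof.
move=> ec; have ed := entire_diffs ec; have edd := entire_diffs ed.
by apply: (@pseries_snd_diffs _ _ (`|x| + 1));
  [exact: is_cvg_psum..|rewrite [ltRHS]ger0_norm ?ltrDl// addr_ge0].
Qed.

Lemma psum_lin c1 c2 (k x : R) : entire c1 -> entire c2 ->
  psum (fun n => c1 n - k * c2 n) x = psum c1 x - k * psum c2 x.
Proof.
move=> e1 e2; apply/cvg_lim => //.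
have -> : pseries (fun n => c1 n - k * c2 n) x =
    (fun n => pseries c1 x n - k * pseries c2 x n).
  apply/funext => n; rewrite /pseries /series/= mulr_sumr -sumrB.
  by apply: eq_bigr => i _; rewrite mulrBl mulrA.
by apply: cvgB; [exact: is_cvg_psum|apply: cvgMr; exact: is_cvg_psum].
Qed.

Definition entire2 b := entire (b \o Posz) /\ entire (b \o Negz).

(** [Negz n] is [-(n + 1)], whence the factor [z^-1] before the second series. *)
Definition laurent b (z : R) : R :=
  psum (b \o Posz) z + z^-1 * psum (b \o Negz) z^-1.

(** The coefficients of [L z / (z - l)]: [h k] is the sum of [b i * l ^ (i - k - 1)] over [i > k],
    or minus the same sum over [i <= k]. The two agree if [L l = 0]; each is used on the side where
    it decays. *)
Definition laurent_quo b (l : R) (k : int) : R :=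
  match k with
  | Posz n => psum (fun j => b (n.+1 + j)%N) l
  | Negz n => - (l^-1 * psum (fun j => b (Negz (n + j))) l^-1)
  end.

(** Peeling off the first term of a tail gives the recurrence on either side; [laurent b l = 0]
    enters at [k = 0], where the two formulas meet. *)
Lemma laurent_quoE b (l : R) : 0 < l -> entire2 b -> laurent b l = 0 ->
  forall k, laurent_quo b l (k - 1) = b k + l * laurent_quo b l k.
Proof.
move=> l0 [ep en] bl; have lN0 : l != 0 by rewrite gt_eqF.
case=> [[|n]|n].
- rewrite /= /laurent_quo/=.
  move: bl; rewrite /laurent psum_recl//=.
  have -> : (fun n => b n.+1) = (fun j => b (1 + j)%N) by [].
  by have -> : (fun j => b (Negz (0 + j))) = b \o Negz by []; lra.
- have -> : n.+1%:Z - 1 = n by rewrite -addn1 PoszD addrK.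
  rewrite /laurent_quo /= psum_recl; last exact: (entire_shift n.+1 ep).
  rewrite addn0; congr (_ + _ * psum _ _); apply/funext => j.
  by rewrite addnS.
- have -> : Negz n - 1 = Negz n.+1 by rewrite !NegzE; lia.
  rewrite /laurent_quo /= [X in _ = _ + _ * - (_ * X)]psum_recl; last exact: (entire_shift n en).
  rewrite addn0; set p := psum _ _; set q := psum _ _.
  have -> : p = q by congr psum; apply/funext => j; rewrite addnS.
  by field.
Qed.

(** A tail starting at index [n] inherits the decay [r ^- n] of the coefficients once [r] is at
    least twice the point of evaluation; [entire_ge] reduces to such [r]. *)
Lemma laurent_quo_entire b (l : R) : 0 < l -> entire2 b ->
  entire2 (laurent_quo b l).
Proof.
move=> l0 [ep en]; split.
- apply: (@entire_ge _ (2 * l)) => [|r lr]; first lra.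
  have r0 : 0 < r by lra.
  have [C HC] := ep _ r0; exists (2 * (C / r)) => n /=.
  have [||_ H] := @psum_bound_cvg (fun j => b (n.+1 + j)%N) l (C / r ^+ n.+1).
  - by rewrite gt_eqF.
  - move=> j; rewrite ler_pdivlMr ?exprn_gt0//.
    apply: le_trans (HC (n.+1 + j)%N); rewrite -mulrA; apply: ler_wpM2l => //.
    rewrite addnC exprD; apply: ler_wpM2r; first by rewrite exprn_ge0// ltW.
    by rewrite gtr0_norm// lerXn2r ?nnegrE//; lra.
  have -> : 2 * (C / r) = 2 * (C / r ^+ n.+1) * r ^+ n.
    by rewrite exprS; field; rewrite expf_neq0 gt_eqF.
  by apply: ler_wpM2r H; rewrite exprn_ge0// ltW.
- have lv0 : 0 < l^-1 by rewrite invr_gt0.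
  apply: (@entire_ge _ (2 * l^-1)) => [|r lr]; first lra.
  have r0 : 0 < r by lra.
  have [C HC] := en _ r0; exists (l^-1 * (2 * C)) => n /=.
  have [||_ H] := @psum_bound_cvg (fun j => b (Negz (n + j)%N)) l^-1 (C / r ^+ n).
  - by rewrite gt_eqF.
  - move=> j; rewrite ler_pdivlMr ?exprn_gt0//.
    apply: le_trans (HC (n + j)%N); rewrite -mulrA; apply: ler_wpM2l => //.
    rewrite addnC exprD; apply: ler_wpM2r; first by rewrite exprn_ge0// ltW.
    by rewrite gtr0_norm// lerXn2r ?nnegrE//; lra.
  have -> : l^-1 * (2 * C) = (l^-1 * (2 * (C / r ^+ n))) * r ^+ n.
    by field; rewrite !gt_eqF ?exprn_gt0.
  apply: ler_wpM2r; first by rewrite exprn_ge0// ltW.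
  by rewrite normrN normrM gtr0_norm//; apply: ler_wpM2l H; exact: ltW.
Qed.

(** The recurrence expresses [b] as the coefficients of the product; multiplication by [z] moves
    [h (- 1)] from the negative to the nonnegative part. *)
Lemma laurent_factor b h (l z : R) : z != 0 -> entire2 h ->
  (forall k, h (k - 1) = b k + l * h k) ->
  laurent b z = (z - l) * laurent h z.
Proof.
move=> z0 [ep en] hb; have bE k : b k = h (k - 1) - l * h k by rewrite hb addrK.
have ep' : entire (fun n : nat => h (n%:Z - 1)).
  apply: (@entire_ge _ 1) => // r r1; have r0 : 0 < r by lra.
  have [C HC] := ep _ r0; exists (Num.max `|h (- 1)| (C * r)) => -[|n].
    by rewrite sub0r expr0 mulr1 le_max lexx.
  rewrite le_max; apply/orP; right; rewrite -addn1 PoszD addrK addn1 exprSr mulrA.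
  by apply: ler_wpM2r; [exact: ltW|exact: HC].
have NegzS n : Negz n - 1 = Negz n.+1 by rewrite !NegzE; lia.
rewrite /laurent.
have -> : b \o Posz = (fun n : nat => h (n%:Z - 1) - l * (h \o Posz) n).
  by apply/funext => n /=; rewrite bE.
have -> : b \o Negz = (fun n : nat => (h \o Negz) n.+1 - l * (h \o Negz) n).
  by apply/funext => n /=; rewrite bE NegzS.
have eS : entire (fun n => (h \o Negz) n.+1) := entire_shift 1 en.
rewrite !psum_lin// [psum (fun n : nat => h _) z]psum_recl//.
rewrite [psum (h \o Negz) z^-1]psum_recl//= sub0r.
have -> : (fun n : nat => h (n.+1%:Z - 1)) = h \o Posz.
  by apply/funext => n /=; rewrite -addn1 PoszD addrK.
by have -> : - 1 = Negz 0 by []; field.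
Qed.

End EntireSeries.

(** * Orders of vanishing of smooth functions *)

Section Smooth.
Context {R : realType}.
Implicit Types (f g : R -> R).

(** A class closed under differentiation that contains [f] and [L \o expR], so that derivatives of
    every order exist by construction. *)
Inductive elementary : (R -> R) -> Prop :=
| elementary_psum c : entire c -> elementary (psum c)
| elementary_expR : elementary expR
| elementary_id : elementary id
| elementary_cst k : elementary (cst k)
| elementaryD f g : elementary f -> elementary g -> elementary (f + g)
| elementaryM f g : elementary f -> elementary g -> elementary (f * g)
| elementary_comp f g : elementary f -> elementary g -> elementary (f \o g).

Lemma elementary_is_derive f : elementary f ->
  exists2 df, elementary df & forall x : R, is_derive x 1 f (df x).
Proof.
elim=> [c ec|||k|{}f g _ [df edf Hf] _ [dg edg Hg]
  |{}f g ef [df edf Hf] eg [dg edg Hg]|{}f g ef [df edf Hf] eg [dg edg Hg]].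
- exists (psum (pseries_diffs c)) => [|x]; last exact: psum_is_derive.
  exact/elementary_psum/entire_diffs.
- by exists expR => [|x]; [exact: elementary_expR|exact: is_derive_expR].
- by exists (cst 1) => [|x]; [exact: elementary_cst|exact: is_derive_id].
- by exists (cst 0) => [|x]; [exact: elementary_cst|exact: is_derive_cst].
- by exists (df + dg) => [|x]; [exact: elementaryD|exact: is_deriveD].
- exists (f * dg + g * df) => [|x]; first by apply: elementaryD; exact: elementaryM.
  exact: is_deriveM.
- exists ((df \o g) * dg) => [|x]; last exact: is_derive1_comp.
  by apply: elementaryM => //; exact: elementary_comp.
Qed.

Lemma elementary_derivable f x : elementary f -> derivable f x 1.
Proof. by move=> /elementary_is_derive[df _ /(_ x)[]]. Qed.

Lemma elementary_continuous f : elementary f -> continuous f.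
Proof.
by move=> ef x; apply: differentiable_continuous; apply/derivable1_diffP/elementary_derivable.
Qed.

Lemma elementary_derive1 f : elementary f -> elementary (derive1 f).
Proof.
move=> /elementary_is_derive[df edf H]; suff -> : derive1 f = df by [].
by apply/funext => x; rewrite derive1E derive_val.
Qed.

(* The neighbourhoods are punctured so that no value at [x] has to be tracked
   when a factor vanishing at [x] is divided out. *)
Definition vanish f (x : R) (m : nat) := exists C : R, exists2 d : R, 0 < d &
  forall y, y != x -> `|y - x| < d -> `|f y| <= C * `|y - x| ^+ m.

Lemma vanish0 f x : {for x, continuous f} -> vanish f x 0.
Proof.
move=> /cvgrPdist_lt/(_ 1 ltr01)/nbhs_ballP[d /= d0 Hd].
exists (`|f x| + 1), d => // y _ yx; rewrite expr0 mulr1.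
have := Hd y; rewrite /ball/= distrC => /(_ yx) fxy.
have := ler_normD (f x) (f y - f x); rewrite addrC subrK distrC; lra.
Qed.

Lemma vanishM f g x m n : vanish f x m -> vanish g x n ->
  vanish (f * g) x (m + n).
Proof.
move=> [C [d d0 Hd]] [D [e e0 He]]; exists (C * D), (Num.min d e).
  by rewrite lt_min d0.
move=> y yx; rewrite lt_min => /andP[yd ye].
rewrite normrM exprD mulrACA.
by apply: ler_pM => //; [exact: Hd|exact: He].
Qed.

Lemma vanish_rescale f x m (k : R) : 0 < k -> vanish f x m ->
  vanish (fun t => f (t / k)) (k * x) m.
Proof.
move=> k0 [C [d d0 Hd]]; exists (C / k ^+ m), (k * d); first exact: mulr_gt0.
move=> t tx td; have E : t / k - x = (t - k * x) / k by field; rewrite gt_eqF.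
have nE : `|t / k - x| = `|t - k * x| / k by rewrite E normrM normfV (gtr0_norm k0).
have tk : t / k != x.
  by rewrite -subr_eq0 E; apply: mulf_neq0; rewrite ?subr_eq0// invr_eq0 gt_eqF.
have := Hd (t / k) tk; rewrite nE ltr_pdivrMr// [d * k]mulrC => /(_ td).
by rewrite expr_div_n mulrA mulrAC.
Qed.

(** Induction on [m], applied to the derivative: since [f x = 0], the mean value theorem gains one
    factor [|y - x|]. *)
Lemma vanish_derive1n f x m : elementary f ->
  (forall j, (j < m)%N -> derive1n j f x = 0) -> vanish f x m.
Proof.
elim: m f => [|m IH] f ef H.
  by apply: vanish0; exact: elementary_continuous.
have [|C [d d0 Hd]] := IH _ (elementary_derive1 ef).
  by move=> j jm; rewrite -derive1Sn; exact: H.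
have fx0 : f x = 0 := H 0%N isT.
have mvt (u v : R) : u < v -> exists2 w, u < w < v & f v - f u = derive1 f w * (v - u).
  move=> uv; have [||w] := @MVT _ f (derive1 f) u v uv.
  - by move=> w _; rewrite derive1E; apply: derivableP; exact: elementary_derivable.
  - by apply: derivable_within_continuous => w _; exact: elementary_derivable.
  - by rewrite in_itv /= => ? ?; exists w.
exists C, d => // y yx yd.
have C0 w : w != x -> `|w - x| < d -> 0 <= C.
  move=> wx wd; have p : 0 < `|w - x| ^+ m by rewrite exprn_gt0// normr_gt0 subr_eq0.
  by rewrite -(pmulr_lge0 _ p) (le_trans _ (Hd _ wx wd)).
have [w [wx wy fE]] : exists w, [/\ w != x, `|w - x| <= `|y - x| & `|f y| = `|derive1 f w| * `|y - x| ].
  have [xy|xy|xy] := ltgtP x y; last by rewrite xy eqxx in yx.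
  - have [w /andP[xw wy] E] := mvt _ _ xy; exists w; split.
    + by rewrite gt_eqF.
    + by rewrite !gtr0_norm; lra.
    + by rewrite -normrM -E fx0 subr0.
  - have [w /andP[yw wx] E] := mvt _ _ xy; exists w; split.
    + by rewrite lt_eqF.
    + by rewrite !ltr0_norm; lra.
    + by rewrite [`|y - x|]distrC -normrM -E fx0 sub0r normrN.
rewrite fE exprSr mulrA; apply: ler_wpM2r => //.
apply: (le_trans (Hd _ wx (le_lt_trans wy yd))); apply: ler_wpM2l; first exact: C0 yx yd.
by rewrite lerXn2r ?nnegrE.
Qed.

Lemma vanish_zero f x m : {for x, continuous f} -> vanish f x m.+1 -> f x = 0.
Proof.
move=> cf [C [d d0 Hd]]; apply/eqP/negPn/negP => fx0.
pose e := `|f x|; have e0 : 0 < e by rewrite normr_gt0.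
have /cvgrPdist_lt/(_ (e / 2) ltac:(lra))/nbhs_ballP[d' /= d'0 Hd'] := cf.
pose K := `|C| + 1; have K0 : 0 < K by rewrite ltr_wpDl.
(* Small enough that [C * t ^+ m.+1 <= e / 2] and that [f (x + t)] is within [e / 2] of [f x],
   against [e = |f x|]. *)
pose t := Num.min (Num.min (d / 2) (d' / 2)) (Num.min 1 (e / 2 / K)).
have t0 : 0 < t by rewrite !lt_min !divr_gt0 ?ltr01.
have [td td' t1 te] : [/\ t <= d / 2, t <= d' / 2, t <= 1 & t <= e / 2 / K].
  by rewrite /t !ge_min !lexx ?orbT.
have nt : `|x + t - x| = t by rewrite addrC addKr gtr0_norm.
have yx : x + t != x by rewrite -subr_eq0 addrC addKr gt_eqF.
have := Hd _ yx; rewrite nt => /(_ ltac:(lra)) H1.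
have := Hd' (x + t); rewrite /ball/= distrC nt => /(_ ltac:(lra)) H2.
have H3 : C * t ^+ m.+1 <= e / 2.
  have tm : t ^+ m.+1 <= t by rewrite exprS ler_piMr ?exprn_ile1// ltW.
  apply: (@le_trans _ _ (K * t)).
    apply: (@le_trans _ _ (K * t ^+ m.+1)); last by rewrite ler_pM2l.
    apply: ler_wpM2r; first by rewrite exprn_ge0// ltW.
    by rewrite (le_trans (ler_norm _))// lerDl.
  by move: te; rewrite ler_pdivlMr// mulrC.
have := ler_normD (f x - f (x + t)) (f (x + t)); rewrite subrK -/e; lra.
Qed.

Lemma expR_dist (u v : R) :
  expR (Num.min u v) * `|u - v| <= `|expR u - expR v|.
Proof.
wlog uv : u v / u <= v.
  move=> H; have [|vu] := orP (le_total u v); first exact: H.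
  by rewrite minC distrC [leRHS]distrC; exact: H.
rewrite min_l// distrC ger0_norm ?subr_ge0// distrC ger0_norm ?subr_ge0 ?ler_expR//.
have -> : v = u + (v - u) by rewrite addrC subrK.
rewrite expRD [u + _ - u]addrC addKr.
have := expR_ge1Dx (v - u); have := expR_gt0 u.
by move=> eu H; rewrite -[X in _ <= _ - X]mulr1 -mulrBr ler_wpM2l ?(ltW eu)//; lra.
Qed.

(** The boolean counts as 0 or 1: the factor [expR y - expR t] has a simple zero at [t] and is
    bounded away from 0 near any other point. *)
Lemma vanish_quo f g (t x : R) m :
  (forall y, f y = (expR y - expR t) * g y) ->
  vanish f x ((t == x) + m)%N -> vanish g x m.
Proof.
move=> fE [C [d d0 Hd]].
(* For [|y - x| < 1] the smaller of [y] and [t] is at least this minimum, so [expR_dist] applies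
   with the constant [c]. *)
pose c := expR (Num.min (x - 1) t); have c0 : 0 < c by exact: expR_gt0.
have low y : `|y - x| < 1 -> c * `|y - t| * `|g y| <= `|f y|.
  move=> yx; rewrite fE normrM ler_wpM2r//.
  apply: le_trans (expR_dist _ _); apply: ler_wpM2r => //.
  rewrite ler_expR le_min !ge_min lexx orbT andbT; apply/orP; left.
  by move: yx; rewrite ltr_norml; lra.
move: Hd low; rewrite {}/c in c0 *; have [tx|tx] := eqVneq t x => Hd low.
  subst x; set c := expR _ in c0 low.
  exists (C / c), (Num.min d 1) => [|y yt]; first by rewrite lt_min d0 ltr01.
  rewrite lt_min => /andP[yd y1].
  have p : 0 < `|y - t| by rewrite normr_gt0 subr_eq0.
  have := le_trans (low _ y1) (Hd y yt yd).
  rewrite add1n exprSr mulrA mulrAC ler_pM2r// mulrC.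
  by rewrite [C / c * _]mulrAC ler_pdivlMr.
set c := expR _ in c0 low.
pose e := `|t - x| / 2; have e0 : 0 < e by rewrite divr_gt0 ?normr_gt0 ?subr_eq0.
exists (C / (c * e)), (Num.min (Num.min d 1) e) => [|y yx]; first by rewrite !lt_min d0 ltr01.
rewrite !lt_min => /andP[/andP[yd y1] ye].
have yt : e <= `|y - t|.
  have := ler_distD y t x; rewrite [`|t - y|]distrC; move: ye; rewrite /e; lra.
rewrite mulrAC ler_pdivlMr ?(mulr_gt0 c0 e0)//.
have := Hd _ yx yd; rewrite add0n; apply: le_trans.
apply: le_trans (low _ y1); rewrite mulrC; apply: ler_wpM2r => //.
by rewrite ler_pM2l.
Qed.

Lemma laurent_elementary (b : int -> R) : entire2 b ->
  elementary (fun t => laurent b (expR t)).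
Proof.
move=> [ep en].
have -> : (fun t => laurent b (expR t)) =
    (psum (b \o Posz) \o expR) +
    (expR \o (cst (-1) * id)) * (psum (b \o Negz) \o (expR \o (cst (-1) * id))).
  by apply/funext => t; rewrite /laurent !fctE/= mulN1r expRN.
have eN : elementary (expR \o (cst (-1) * id)).
  apply: elementary_comp; first exact: elementary_expR.
  by apply: elementaryM; [exact: elementary_cst|exact: elementary_id].
apply: elementaryD.
  by apply: elementary_comp; [exact: elementary_psum|exact: elementary_expR].
apply: elementaryM => //.
by apply: elementary_comp => //; exact: elementary_psum.
Qed.

End Smooth.

(** * Weighted sup norms under division by a linear factor *)

Section WeightedNorms.
Context {R : realType}.
Implicit Types (b h : int -> R).

Lemma entire2_bound h (s : R) : entire2 h ->
  exists C, forall k, `|h k| * expR (s * k%:~R) <= C.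
Proof.
move=> [ep en]; have [C1 H1] := ep _ (expR_gt0 s).
have [C2 H2] := en _ (expR_gt0 (- s)).
exists (Num.max C1 (C2 * expR (- s))) => -[n|n]; rewrite le_max; apply/orP.
  by left; rewrite -pmulrn expRM_natr; exact: H1.
right; rewrite NegzE mulrNz mulrN -mulNr -pmulrn expRM_natr exprSr mulrA.
by rewrite ler_pM2r ?expR_gt0//; have := H2 n; rewrite /= NegzE.
Qed.

(** The supremum [S] of [u] satisfies [p * S <= M + q * S]; the a priori bound [B] makes [S] finite,
    so that [q * S] can be subtracted. *)
Lemma sup_contract (T : Type) (u : T -> R) (B M p q : R) :
  (forall k, u k <= B) -> 0 <= q -> q < p ->
  (forall k, exists j, p * u k <= M + q * u j) ->
  forall k, (p - q) * u k <= M.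
Proof.
move=> uB q0 qp H k0; pose S := sup (range u).
have hs : has_sup (range u).
  by split; [exists (u k0), k0|exists B => _ [k _ <-]].
have uS k : u k <= S by apply: sup_upper_bound => //; exists k.
have p0 : 0 < p by lra.
have SM : S <= (M + q * S) / p.
  apply: ge_sup; first by case: hs.
  move=> _ [k _ <-]; rewrite ler_pdivlMr// mulrC.
  have [j Hj] := H k; apply: (le_trans Hj); rewrite lerD2l ler_wpM2l//.
apply: (@le_trans _ _ ((p - q) * S)); first by rewrite ler_wpM2l// subr_ge0 ltW.
by move: SM; rewrite ler_pdivlMr//; lra.
Qed.

(** The recurrence is solved for [expR t * h k] if [s < t] and for [h (k - 1)] if [s > t], so that
    the larger of [expR s] and [expR t] becomes the [p] of [sup_contract]. *)
Lemma quo_norm b h (s t M : R) : entire2 h ->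
  (forall k, h (k - 1) = b k + expR t * h k) ->
  (forall k, `|b k| * expR (s * k%:~R) <= M) ->
  forall k, `|expR s - expR t| * (`|h k| * expR (s * k%:~R)) <= M.
Proof.
move=> eh hb bM; have [B hB] := entire2_bound s eh.
have es := expR_gt0 s; have et := expR_gt0 t.
have step k : expR (s * (k + 1)%:~R) = expR s * expR (s * k%:~R).
  by rewrite -expRD rmorphD/= mulrDr mulr1 addrC.
have [st|st|st] := ltgtP (expR s) (expR t) => k.
- rewrite ltr0_norm ?subr_lt0// opprB.
  apply: (sup_contract hB (ltW es) st) => {}k; exists (k - 1).
  have := step (k - 1); rewrite subrK => E.
  have H : expR t * `|h k| <= `|h (k - 1)| + `|b k|.
    rewrite -{1}(gtr0_norm et) -normrM (_ : expR t * h k = h (k - 1) - b k).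
      exact: ler_normB.
    by rewrite hb; ring.
  rewrite mulrA [expR s * _]mulrCA -E; have := bM k.
  move: (expR_gt0 (s * k%:~R)); set w := expR _ => w0 Hb.
  apply: (@le_trans _ _ ((`|h (k - 1)| + `|b k|) * w)); first by rewrite ler_pM2r.
  by rewrite mulrDl addrC lerD2r.
- rewrite gtr0_norm ?subr_gt0//.
  apply: (sup_contract hB (ltW et) st) => {}k; exists (k + 1).
  rewrite mulrCA -step; have := bM (k + 1); have := hb (k + 1); rewrite addrK => ->.
  set w := expR _; have w0 : 0 < w by exact: expR_gt0.
  move=> Hb; apply: (@le_trans _ _ ((`|b (k + 1)| + `|expR t * h (k + 1)|) * w)).
    by rewrite ler_pM2r// ler_normD.
  by rewrite mulrDl normrM (gtr0_norm et) -mulrA lerD2r.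
- rewrite st subrr normr0 mul0r; apply: le_trans (bM 0).
  by rewrite mulr_ge0// ltW// expR_gt0.
Qed.

(* [s = N + 6] leaves enough room to absorb the factors [1 - l / rho] and
   [(1 + l)^2 <= 4 max(1, l)^2], because [expR 6 >= 16]. *)
Lemma quo_factor (N t : R) : `|t| <= N ->
  (1 + expR t) ^+ 2 <= expR (- (N - `|t|)) *
    (`|expR (N + 6) - expR t| * `|expR (- (N + 6)) - expR t|).
Proof.
move=> tN; have /andP[tN1 tN2] : - N <= t <= N by rewrite -ler_norml.
have e6 : 16 <= expR 6 :> R.
  have -> : 6 = 3 * 2%:R :> R by ring.
  rewrite expRM_natr; have := expR_ge1Dx (3 : R) => H.
  have -> : 16 = 4 ^+ 2 :> R by ring.
  by rewrite lerXn2r ?nnegrE; lra.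
pose l := expR t; pose q := expR (- 6) : R.
have l0 : 0 < l by exact: expR_gt0.
have q0 : 0 < q by exact: expR_gt0.
have q16 : q * 16 <= 1.
  by rewrite /q expRN mulrC ler_pdivrMr ?expR_gt0// mul1r.
have D1 : expR (N + 6) * (15 / 16) <= `|expR (N + 6) - l|.
  have H : l <= q * expR (N + 6) by rewrite /q -expRD ler_expR; lra.
  have p := expR_gt0 (N + 6).
  have H2 : q * expR (N + 6) * 16 <= expR (N + 6) by rewrite mulrAC ler_piMl// ltW.
  by rewrite ger0_norm; lra.
have D2 : l * (15 / 16) <= `|expR (- (N + 6)) - l|.
  have H : expR (- (N + 6)) <= q * l by rewrite /q /l -expRD ler_expR; lra.
  have H2 : q * l * 16 <= l by rewrite mulrAC ler_piMl// ltW.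
  by rewrite distrC ger0_norm; lra.
have E : expR (- (N - `|t|)) * expR (N + 6) = expR (`|t|) * expR 6.
  by rewrite -!expRD; congr expR; ring.
have L : (1 + l) ^+ 2 <= 4 * (expR `|t| * l).
  have [t0|t0] := leP 0 t.
    have l1 : 1 <= l by rewrite -expR0 ler_expR.
    by rewrite ger0_norm// -/l; nra.
  have l1 : l <= 1 by rewrite -expR0 ler_expR ltW.
  by rewrite ltr0_norm// -expRD addNr expR0; nra.
have p := expR_gt0 (- (N - `|t|)).
apply: (@le_trans _ _ (expR (- (N - `|t|)) * ((expR (N + 6) * (15 / 16)) * (l * (15 / 16))))).
  have -> : expR (- (N - `|t|)) * (expR (N + 6) * (15 / 16) * (l * (15 / 16))) =
     (expR (- (N - `|t|)) * expR (N + 6)) * l * (15 / 16) ^+ 2 by ring.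
  rewrite E; apply: (le_trans L); set w := expR `|t|.
  have w0 : 0 < w * l by rewrite mulr_gt0// expR_gt0.
  have -> : w * expR 6 * l * (15 / 16) ^+ 2 = (w * l) * (expR 6 * (15 / 16) ^+ 2) by ring.
  rewrite mulrC ler_pM2l//; nra.
rewrite ler_pM2l//; apply: ler_pM => //; rewrite mulr_ge0 ?ltW ?expR_gt0//; lra.
Qed.

(** Induction on [s], where a zero may be repeated up to its order. Dividing out one zero divides
    [M1 * M2] by [d1 * d2], and returning from [h] to [b] costs [(1 + l) ^+ 2]; [quo_factor] bounds
    the net effect by [expR (- (N - |t|))]. *)
Lemma laurent_coef_bound (N : R) (s : seq R) b (M1 M2 : R) : entire2 b ->
  (forall t, t \in s -> `|t| <= N) ->
  (forall t, t \in s ->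
     vanish (fun y => laurent b (expR y)) t (count_mem t s)) ->
  (forall k, `|b k| * expR ((N + 6) * k%:~R) <= M1) ->
  (forall k, `|b k| * expR (- (N + 6) * k%:~R) <= M2) ->
  forall k, `|b k| ^+ 2 <= M1 * M2 * expR (- \sum_(t <- s) (N - `|t|)).
Proof.
elim: s b M1 M2 => [|t s IH] b M1 M2 eb sN van bM1 bM2 k.
  (* The two weights at [k] are inverse to each other, so the product of the two bounds has no
     weight left. *)
  rewrite big_nil oppr0 expR0 mulr1 expr2.
  have p x : 0 <= `|b k| * expR x by rewrite mulr_ge0// ltW// expR_gt0.
  have := ler_pM (p _) (p _) (bM1 k) (bM2 k).
  by rewrite mulrACA -expRD mulNr subrr expR0 mulr1.
have ts : t \in t :: s by rewrite mem_head.
have tN := sN t ts.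
have bt : laurent b (expR t) = 0.
  apply: (@vanish_zero _ (fun y => laurent b (expR y)) t (count_mem t s)).
    exact: (elementary_continuous (laurent_elementary eb)).
  by have := van t ts; rewrite /= eqxx.
have l0 := expR_gt0 t; set l := expR t in l0 bt.
pose h := laurent_quo b l.
have eh : entire2 h by exact: laurent_quo_entire.
have hb : forall k, h (k - 1) = b k + l * h k by exact: laurent_quoE.
have N1 := quo_norm eh hb bM1; have N2 := quo_norm eh hb bM2.
pose d1 : R := `|expR (N + 6) - l|; pose d2 : R := `|expR (- (N + 6)) - l|.
have D1 : 0 < d1.
  rewrite normr_gt0 subr_eq0 gt_eqF// ltr_expR; move: tN; rewrite ler_norml; lra.
have D2 : 0 < d2.
  rewrite normr_gt0 subr_eq0 lt_eqF// ltr_expR; move: tN; rewrite ler_norml; lra.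
have hk j : `|h j| ^+ 2 <= M1 / d1 * (M2 / d2) *
    expR (- \sum_(t <- s) (N - `|t|)).
  apply: IH => [//|x xs|x xs|i|i].
  - by apply: sN; rewrite inE xs orbT.
  - apply: (@vanish_quo _ _ _ t).
      by move=> y; apply: laurent_factor; rewrite ?gt_eqF ?expR_gt0.
    by have := van x; rewrite /= inE xs orbT => /(_ isT).
  - by rewrite ler_pdivlMr// mulrC; exact: N1.
  - by rewrite ler_pdivlMr// mulrC; exact: N2.
set e := expR (- \sum_(t <- s) _) in hk.
have QF := quo_factor tN; rewrite -/l -/d1 -/d2 in QF.
set Q := M1 / d1 * (M2 / d2) * e in hk.
have Q0 : 0 <= Q := le_trans (exprn_ge0 2 (normr_ge0 _)) (hk k).
have hs j : `|h j| <= Num.sqrt Q by rewrite -[leLHS]ger0_norm// -sqrtr_sqr ler_wsqrtr.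
have bk : `|b k| <= (1 + l) * Num.sqrt Q.
  have -> : b k = h (k - 1) - l * h k by rewrite hb addrK.
  apply: (le_trans (ler_normB _ _)); rewrite mulrDl mul1r; apply: lerD => //.
  by rewrite normrM gtr0_norm// ler_pM2l.
apply: (@le_trans _ _ (((1 + l) * Num.sqrt Q) ^+ 2)).
  by rewrite lerXn2r ?nnegrE// mulr_ge0 ?sqrtr_ge0//; lra.
rewrite exprMn sqr_sqrtr//; apply: (le_trans (ler_wpM2r Q0 QF)).
rewrite big_cons [- (_ + \sum_(_ <- _) _)]opprD [expR (_ - \sum_(_ <- _) _)]expRD.
rewrite -/e le_eqVlt; apply/orP; left; apply/eqP.
by rewrite /Q; field; rewrite !gt_eqF.
Qed.

End WeightedNorms.

(** * Zeros of a real Gaussian series *)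

Section GaussianSeries.
Context {R : realType}.
Variables (a M : R) (d : int -> R).
Hypotheses (a0 : 0 < a) (dM : forall k, `|d k| <= M).

Definition gcoef (k : int) : R := d k * gauss a k%:~R.

(** Completing the square: [s * k - a * k ^ 2] is at most its value [s ^ 2 / (4 * a)] at
    [k = s / (2 * a)]. *)
Lemma gcoef_bound (s : R) k :
  `|gcoef k| * expR (s * k%:~R) <= M * expR (s ^+ 2 / (4 * a)).
Proof.
have g0 : 0 < gauss a k%:~R by exact: expR_gt0.
rewrite /gcoef normrM (gtr0_norm g0) -mulrA -expRD.
apply: ler_pM => //.
rewrite ler_expR -subr_ge0.
have -> : s ^+ 2 / (4 * a) - (- (a * k%:~R ^+ 2) + s * k%:~R) =
  a * (k%:~R - s / (2 * a)) ^+ 2 by field; rewrite gt_eqF.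
by rewrite mulr_ge0 ?sqr_ge0// ltW.
Qed.

Lemma gcoef_entire : entire2 gcoef.
Proof.
split=> r r0.
  exists (M * expR ((ln r) ^+ 2 / (4 * a))) => n.
  by have := gcoef_bound (ln r) n; rewrite -pmulrn expRM_natr lnK.
exists (M * expR ((ln r) ^+ 2 / (4 * a)) / r) => n; rewrite ler_pdivlMr//.
have := gcoef_bound (- ln r) (Negz n); rewrite sqrrN.
by rewrite [in (Negz n)%:~R]NegzE mulrNz mulrNN -pmulrn expRM_natr lnK// exprSr mulrA.
Qed.

(** Expanding [(x - k) ^ 2] pulls out [gauss a x]; the symmetric partial sum has [n + 1] nonnegative
    and [n] negative indices. *)
Lemma gpsumE x n : gpsum a d x n = gauss a x *
  (pseries (gcoef \o Posz) (expR (2 * a * x)) n.+1 +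
   (expR (2 * a * x))^-1 * pseries (gcoef \o Negz) (expR (2 * a * x))^-1 n).
Proof.
have termE k : d k * gauss a (x - k%:~R) =
    gauss a x * (gcoef k * expR (2 * a * x * k%:~R)).
  transitivity (d k * (gauss a x * gauss a k%:~R * expR (2 * a * x * k%:~R))).
    by rewrite /gauss -!expRD; congr (_ * expR _); ring.
  by rewrite /gcoef; ring.
rewrite /gpsum; under eq_bigr do rewrite termE.
rewrite -mulr_sumr; congr (_ * _).
rewrite (big_cat_nat (n := n))//=; last lia.
rewrite addrC; congr (_ + _).
  rewrite -{1}[n]add0n big_addn (_ : (2 * n).+1 - n = n.+1)%N; last lia.
  rewrite /pseries/series/=; apply: eq_bigr => i _.
  by rewrite PoszD addrK -pmulrn expRM_natr.
rewrite big_nat_rev/= mulr_sumr /pseries/series/= !big_nat; apply: eq_bigr => i /andP[_ ni].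
have -> : (0 + n - i.+1)%N%:Z - n%:Z = Negz i by rewrite NegzE; lia.
rewrite mulrCA; congr (_ * _).
by rewrite NegzE mulrNz mulrN -pmulrn expRN expRM_natr -exprVn exprS.
Qed.

Lemma gsum_laurent x :
  limn (gpsum a d x) = gauss a x * laurent gcoef (expR (2 * a * x)).
Proof.
have [ep en] := gcoef_entire.
apply/cvg_lim => //; have /funext-> := gpsumE x.
apply: cvgMr; apply: cvgD.
  by rewrite (cvg_shiftS (pseries _ _)); exact: is_cvg_psum.
by apply: cvgMr; exact: is_cvg_psum.
Qed.

Let f x := limn (gpsum a d x).

Lemma gsum_elementary : elementary f.
Proof.
have -> : f = (expR \o (cst (- a) * (id * id))) *
    ((fun t => laurent gcoef (expR t)) \o (cst (2 * a) * id)).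
  apply/funext => x; rewrite /f gsum_laurent /gauss !fctE/=.
  by rewrite expr2 mulNr.
apply: elementaryM; apply: elementary_comp.
- exact: elementary_expR.
- apply: elementaryM; first exact: elementary_cst.
  by apply: elementaryM; exact: elementary_id.
- by apply: laurent_elementary; exact: gcoef_entire.
- by apply: elementaryM; [exact: elementary_cst|exact: elementary_id].
Qed.

Lemma gsum_vanish x m : (forall j, (j < m)%N -> derive1n j f x = 0) ->
  vanish (fun t => laurent gcoef (expR t)) (2 * a * x) m.
Proof.
move=> fx; have a2 : 0 < 2 * a by rewrite mulr_gt0.
have := vanish_rescale a2 (vanish_derive1n gsum_elementary fx).
(* At [t = 2 * a * x] this is [expR (a * x ^+ 2)], which cancels the Gaussian; being continuous, it
   costs no order of vanishing. *)
pose g : R -> R := expR \o (cst (a / (2 * a) ^+ 2) * (id * id)).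
have eg : elementary g.
  apply: elementary_comp; first exact: elementary_expR.
  apply: elementaryM; first exact: elementary_cst.
  by apply: elementaryM; exact: elementary_id.
move=> /vanishM /(_ (vanish0 (elementary_continuous eg (x := 2 * a * x)))).
rewrite addn0; congr (vanish _ _ _); apply/funext => t.
rewrite /f /g !fctE gsum_laurent /gauss /= mulrAC -expRD.
have aN : a != 0 by rewrite gt_eqF.
rewrite (_ : _ + _ = 0); last by field.
by rewrite expR0 mul1r; congr (laurent _ (expR _)); field.
Qed.

Lemma gsum_neq0_coef x : f x <> 0 -> exists k, gcoef k != 0.
Proof.
move=> fx; apply: contra_notP fx => /forallNP H; rewrite /f gsum_laurent.
have E k : gcoef k = 0 by apply/eqP/negPn/negP; exact: H.
have Z (z : R) : psum (fun=> 0) z = 0.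
  apply/cvg_lim => //; rewrite (_ : pseries _ _ = fun=> 0); first exact: cvg_cst.
  by apply/funext => n; rewrite /pseries/series/= big1// => i _; rewrite mul0r.
have Ep : gcoef \o Posz = (fun=> 0) by apply/funext => n; exact: E.
have En : gcoef \o Negz = (fun=> 0) by apply/funext => n; exact: E.
by rewrite /laurent Ep En !Z mulr0 addr0 mulr0.
Qed.

(** The logarithm of [laurent_coef_bound] at one fixed nonzero coefficient; [K] depends on neither
    [n] nor [s], as the counting requires. *)
Lemma gsum_zeros_bound x0 : f x0 <> 0 -> exists K : R, forall (n : R) (s : seq R),
  (forall x, x \in s -> `|x| <= n) ->
  (forall x, x \in s ->
     forall j, (j < count_mem x s)%N -> derive1n j f x = 0) ->
  \sum_(x <- s) (n - `|x|) <= (n + 3 / a) ^+ 2 + K.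
Proof.
move=> /gsum_neq0_coef[k k0]; have a2 : 0 < 2 * a by rewrite mulr_gt0.
have p : 0 < `|gcoef k| ^+ 2 by rewrite exprn_gt0// normr_gt0.
exists (ln (M * M / `|gcoef k| ^+ 2) / (2 * a)) => n s sn fs.
pose s' := [seq 2 * a * x | x <- s]; pose N := 2 * a * n.
have inj : injective ( *%R (2 * a)) by apply: mulfI; rewrite gt_eqF.
have cE x : count_mem (2 * a * x) s' = count_mem x s.
  by rewrite count_map; apply: eq_count => y /=; rewrite (inj_eq inj).
have B := @gcoef_bound (N + 6); have B' := @gcoef_bound (- (N + 6)).
rewrite sqrrN in B'.
have := laurent_coef_bound (s := s') gcoef_entire _ _ B B' k.
have sumE : \sum_(t <- s') (N - `|t|) = 2 * a * \sum_(x <- s) (n - `|x|).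
  rewrite big_map mulr_sumr; apply: eq_bigr => x _.
  by rewrite normrM (gtr0_norm a2) mulrBr.
rewrite sumE => H.
have {}H : `|gcoef k| ^+ 2 <= M * M *
    expR ((N + 6) ^+ 2 / (2 * a) - 2 * a * \sum_(x <- s) (n - `|x|)).
  rewrite (le_trans (H _ _))//.
  - by move=> _ /mapP[x xs ->]; rewrite normrM (gtr0_norm a2) ler_pM2l// sn.
  - by move=> _ /mapP[x xs ->]; rewrite cE; apply: gsum_vanish; exact: fs.
  have -> : (N + 6) ^+ 2 / (2 * a) = (N + 6) ^+ 2 / (4 * a) + (N + 6) ^+ 2 / (4 * a).
    by field; rewrite gt_eqF.
  by rewrite !expRD le_eqVlt; apply/orP; left; apply/eqP; ring.
set S := \sum_(x <- s) _ in H *.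
have MM : 0 < M * M.
  by rewrite -(pmulr_lgt0 _ (expR_gt0 ((N + 6) ^+ 2 / (2 * a) - 2 * a * S))) (lt_le_trans p).
have {}H : 2 * a * S - (N + 6) ^+ 2 / (2 * a) <= ln (M * M / `|gcoef k| ^+ 2).
  rewrite -[leLHS]expRK ler_ln ?posrE ?expR_gt0 ?divr_gt0//.
  rewrite ler_pdivlMr// -(ler_pM2r (expR_gt0 ((N + 6) ^+ 2 / (2 * a) - 2 * a * S))).
  by rewrite mulrAC -expRD addrC subrKA subrr expR0 mul1r.
(* The shift [3 / a] arises from [N + 6 = 2 * a * (n + 3 / a)]. *)
have -> : (n + 3 / a) ^+ 2 = (N + 6) ^+ 2 / (2 * a) / (2 * a).
  by rewrite /N; field; rewrite gt_eqF.
by rewrite -mulrDl ler_pdivlMr// mulrC -lerBlDl.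
Qed.

End GaussianSeries.

(** * From the Jensen-type bound to the lower density *)

Section Counting.
Context {R : realType}.

Lemma quadratic_unbounded (e A B : R) : 0 < e ->
  ~ forall n : nat, e * n%:R ^+ 2 <= A * n%:R + B.
Proof.
move=> e0 H; pose C := (`|A| + `|B|) / e; pose n := (Num.bound C).+1.
have C0 : 0 <= C by rewrite divr_ge0 ?addr_ge0 ?(ltW e0).
have nC : C < n%:R.
  by rewrite (lt_le_trans (archi_boundP C0))// ler_nat.
have n1 : 1 <= n%:R :> R by rewrite ler1n.
have := H n; move: nC; rewrite /C ltr_pdivrMr// => nC Hn.
have A1 : A * n%:R <= `|A| * n%:R by rewrite ler_wpM2r ?ler_norm// (le_trans ler01).
have B1 : B <= `|B| * n%:R by rewrite (le_trans (ler_norm _))// ler_peMr.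
have : (`|A| + `|B|) * n%:R < n%:R * e * n%:R by rewrite ltr_pM2r// (lt_le_trans ltr01).
nra.
Qed.

(** Discrete form of [n - y] as the integral over [[0, n]] of the indicator of [y <= t]; with
    [y = |x|] it turns the Jensen sum into counts at integer radii. *)
Lemma sum_indic_le (J n : nat) (y : R) : 0 <= y <= n%:R ->
  \sum_(0 <= j < n) ((J <= j)%N && (y <= j%:R))%:R <= n%:R - y.
Proof.
elim: n => [|n IH] /andP[y0 yn]; first by rewrite big_geq//; lra.
rewrite big_nat_recr//= -natr1.
have [yn'|ny] := leP y n%:R.
  rewrite andbT; have := IH; rewrite y0 yn' => /(_ isT).
  by case: (J <= n)%N => /=; lra.
rewrite andbF addr0 big_nat big1; last first.
  move=> i /andP[_ ni]; rewrite [y <= _]leNgt (lt_trans _ ny) ?ltr_nat// andbF.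
  by [].
by rewrite -natr1 in yn; lra.
Qed.

(** The full sum of [2 * j] is [n * (n - 1)], and the terms with [j < J] take away at most
    [J ^ 2]. *)
Lemma sum_tail_ge (J n : nat) :
  n%:R * (n%:R - 1) - J%:R ^+ 2 <=
  \sum_(0 <= j < n) (J <= j)%N%:R * (2 * j%:R) :> R.
Proof.
elim: n => [|n IH].
  by rewrite big_geq// mul0r sub0r oppr_le0 exprn_ge0.
rewrite big_nat_recr//=; have [Jn|nJ] := leqP J n.
  by rewrite mul1r -natr1; lra.
rewrite mul0r addr0; apply: (@le_trans _ _ 0).
  rewrite -natr1 addrK subr_le0 expr2.
  by apply: ler_pM; rewrite ?natr1 ?ler_nat// ltnW.
by apply: sumr_ge0 => i _; rewrite mulr_ge0// mulr_ge0.
Qed.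

(** [P x m] stands for vanishing to order at least [m] at [x]. A density above 1 in all long windows
    about 0, summed over integer radii, contradicts the quadratic bound. *)
Lemma lower_density_le1 (N : set R) (P : R -> nat -> Prop) (q K : R) :
  (forall x, P x 0%N) -> (forall x, N x -> P x 1%N) ->
  (forall (n : R) (s : seq R), (forall x, x \in s -> `|x| <= n) ->
    (forall x, x \in s -> P x (count_mem x s)) ->
    \sum_(x <- s) (n - `|x|) <= (n + q) ^+ 2 + K) ->
  (lower_density N (fun x => ereal_sup [set (m%:R)%:E | m in [set m | P x m]]) <= 1)%E.
Proof.
move=> P0 P1 bound.
(* For [m] copies of [x] and radius [|x| + 1] the sum in [bound] equals [m]; hence multiplicities
   are finite. *)
pose B (y : R) : nat := Num.bound `|(y + 1 + q) ^+ 2 + K|.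
have boundN (x : R) m : P x m -> (m <= B `|x|%R)%N.
  move=> Pm; have := bound (`|x| + 1) (nseq m x).
  have -> : \sum_(y <- nseq m x) (`|x| + 1 - `|y|) = m%:R.
    by rewrite big_nseq -Monoid.iteropE /= addrC addKr -/(1 *+ m).
  move=> H; rewrite ltnW// -(ltr_nat R).
  apply: le_lt_trans (archi_boundP (normr_ge0 _)).
  apply: le_trans (ler_norm _); apply: H => y; rewrite mem_nseq => /andP[m0 /eqP->].
    by rewrite lerDl.
  by rewrite count_nseq /= eqxx mul1n.
have /choice[mu muP] (x : R) : exists m, P x m /\ forall m', P x m' -> (m' <= m)%N.
  have ex : exists m, `[< P x m >] by exists 0%N; apply/asboolP.
  case: (ex_maxnP ex (fun m => boundN x m \o @asboolW _)) => m /asboolP Pm Hm.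
  by exists m; split=> // m' Pm'; apply: Hm; apply/asboolP.
have wE x : ereal_sup [set (m%:R)%:E | m in [set m | P x m]] = ((mu x)%:R)%:E :> \bar R.
  have [Pm Hm] := muP x; apply/eqP; rewrite eq_le; apply/andP; split.
    by apply: ub_ereal_sup => _ [m Pxm <-]; rewrite lee_fin ler_nat Hm.
  by apply: ereal_sup_ubound; exists (mu x).
pose A (n : nat) := N `&` [set x | `|x| <= n%:R].
(* In [bound] with radius [n + 1], each zero in [[-n, n]] contributes at least 1. *)
have finA n : finite_set (A n).
  apply: contrapT => /(infinite_set_fset (B n%:R).+1) [F FA]; apply/negP; rewrite -ltnNge ltnS ltnW// -(ltr_nat R).
  apply: le_lt_trans (archi_boundP (normr_ge0 _)); apply: le_trans (ler_norm _).
  have FP x : x \in finmap.enum_fset F -> N x /\ `|x| <= n%:R by move=> xB; exact: FA.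
  apply: le_trans (bound (n%:R + 1) (finmap.enum_fset F) _ _) => [|x /FP[_ xn]|x xB].
  - rewrite -sum1_size natr_sum; rewrite big_seq [leRHS]big_seq; apply: ler_sum => x /FP[_ xn]; lra.
  - lra.
  - by rewrite count_uniq_mem ?finmap.fset_uniq// xB; apply: P1; case: (FP x xB).
rewrite /lower_density; apply: ub_ereal_sup => _ [r0 _ <-].
rewrite leNgt; apply/negP => D1.
(* [D] is the infimum over [r >= r0], or 2 if that is infinite. *)
have [D D1' DH] : exists2 D : R, 1 < D & forall r x : R, r0 <= r ->
    (D%:E <= ((2 * r)^-1)%:E *
      \esum_(l in N `&` [set l : R | (x - r <= l <= x + r)%R]) ((mu l)%:R)%:E)%E.
  have [D D1' DH] : exists2 D : R, 1 < D & (D%:E <= ereal_inf [set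
      ereal_inf [set (((2 * r)^-1)%:E *
        \esum_(l in N `&` [set l : R | (x - r <= l <= x + r)%R])
          ereal_sup [set (m%:R)%:E | m in [set m | P l m]])%E | x in [set: R]]
      | r in [set r | (r0 <= r)%R]])%E.
    move: D1; set e := ereal_inf _; case: e => [D||].
    + by rewrite lte_fin => D1; exists D.
    + by exists 2; rewrite ?leey ?ltr1n.
    + by [].
  exists D => // r x r0r; apply: (le_trans DH).
  apply: (@le_trans _ _ (ereal_inf [set (((2 * r)^-1)%:E *
        \esum_(l in N `&` [set l : R | (x - r <= l <= x + r)%R])
          ereal_sup [set (m%:R)%:E | m in [set m | P l m]])%E | x in [set: R]])).
    by apply: ereal_inf_lbound; exists r.
  apply: ereal_inf_lbound; exists x => //.
  by congr (_ * _)%E; apply: eq_esum => l _; rewrite wE.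
(* Integer radii [j >= J] are at least [r0]; from here on all windows are centred at 0. *)
pose J := (Num.bound `|r0|).+1.
have count_ge (n j : nat) : (J <= j)%N -> (j <= n)%N ->
    D * (2 * j%:R) <= \sum_(x <- finmap.enum_fset (fset_set (A n))) (mu x)%:R * (`|x| <= j%:R)%R%:R.
  move=> Jj jn; have j0 : (0 < j)%N by lia.
  have r0j : r0 <= j%:R.
    apply: (le_trans (ler_norm _)); apply: ltW.
    apply: (lt_le_trans (archi_boundP (normr_ge0 _))); rewrite ler_nat.
    exact: leq_trans Jj.
  have := DH j%:R 0 r0j.
  have -> : N `&` [set l : R | 0 - j%:R <= l <= 0 + j%:R] = A n `&` [set x | `|x| <= j%:R].
    apply/seteqP; split=> l /=; rewrite sub0r add0r -ler_norml => -[].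
      move=> Nl lj; split=> //; split=> //=.
      by rewrite (le_trans lj)// ler_nat.
    by move=> [Nl _] lj.
  rewrite esum_mkcondr esum_fset//; last by move=> i _; case: ifP => _; rewrite ?lee_fin.
  rewrite fsbig_finite//=.
  rewrite (eq_bigr (fun x => ((mu x)%:R * (`|x| <= j%:R)%R%:R)%:E)); last first.
    move=> x _; have [xj|xj] := boolP (`|x| <= j%:R); first by rewrite mem_set// mulr1.
    by rewrite memNset ?mulr0//=; apply/negP.
  rewrite sumEFin.
  by rewrite -EFinM lee_fin mulrC ler_pdivlMr// mulr_gt0// ltr0n.
(* These coefficients come from [D * (n * (n - 1) - J ^+ 2) <= (n + q) ^+ 2 + K]. *)
apply: (@quadratic_unbounded (D - 1) (D + 2 * q) (q ^+ 2 + K + D * J%:R ^+ 2)).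
  by rewrite subr_gt0.
move=> n; pose Z := finmap.enum_fset (fset_set (A n)).
have ZA x : x \in Z -> N x /\ `|x| <= n%:R.
  by move=> xZ; have /set_mem : x \in A n by rewrite -(in_fset_set (finA n)).
pose s := flatten [seq nseq (mu x) x | x <- Z].
have cs x : x \in Z -> count_mem x s = mu x.
  move=> xZ; rewrite /s count_flatten -map_comp sumnE big_map.
  rewrite (bigD1_seq x)//= ?finmap.fset_uniq// count_nseq /= eqxx mul1n big1 ?addn0//.
  by move=> y /negPf yx; rewrite count_nseq /= yx.
have sZ x : x \in s -> x \in Z.
  by move=> /flattenP[_ /mapP[y yZ ->]]; rewrite mem_nseq => /andP[_ /eqP->].
have sn x : x \in s -> `|x| <= n%:R by move=> /sZ/ZA[].
have sP x : x \in s -> P x (count_mem x s).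
  by move=> xs; rewrite cs ?sZ//; case: (muP x).
have := bound n%:R s sn sP.
have -> : \sum_(x <- s) (n%:R - `|x|) = \sum_(x <- Z) (mu x)%:R * (n%:R - `|x|).
  rewrite /s big_flatten big_map; apply: eq_bigr => x _.
  by rewrite big_nseq -Monoid.iteropE /= mulr_natl.
have low : D * (n%:R * (n%:R - 1) - J%:R ^+ 2) <= \sum_(x <- Z) (mu x)%:R * (n%:R - `|x|).
  apply: (@le_trans _ _ (\sum_(x <- Z) (mu x)%:R *
      \sum_(0 <= j < n) ((J <= j)%N && (`|x| <= j%:R))%:R)); last first.
    rewrite big_seq [leRHS]big_seq; apply: ler_sum => x /ZA[_ xn]; rewrite ler_wpM2l//.
    by apply: sum_indic_le; rewrite normr_ge0.
  (* After swapping the sums, the inner one counts the zeros in [[-j, j]], and [count_ge]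
     applies. *)
  under eq_bigr do rewrite mulr_sumr.
  rewrite exchange_big /=.
  apply: (le_trans (ler_wpM2l (ltW (lt_trans ltr01 D1')) (sum_tail_ge J n))).
  rewrite mulr_sumr; apply: ler_sum_nat => j /andP[_ jn].
  have [Jj|jJ] := leqP J j; last by rewrite mul0r mulr0 sumr_ge0// => x _; rewrite mulr_ge0.
  by rewrite mul1r; apply: count_ge => //; exact: ltnW.
nra.
Qed.

End Counting.

(** * The density bound for complex coefficients *)

Unset Implicit Arguments.

Theorem theorem4p3 (R : realType) (a : R) (c : int -> R[i]) :
  0 < a ->
  (exists M : R, forall k : int, `|c k| <= (M%:C)%C) ->
  (exists x : R, fRe a c x <> 0 \/ fIm a c x <> 0) ->
  (lower_density (zeroset a c) (mult a c) <= 1)%E.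
Proof.
move=> a0 [M cM] [x0 fx0].
have ReM k : `|complex.Re (c k)| <= M.
  by rewrite -lecR (le_trans (normc_ge_Re _)).
have ImM k : `|complex.Im (c k)| <= M.
  have := cM k; rewrite normc_def lecR; apply: le_trans.
  by rewrite -sqrtr_sqr ler_wsqrtr// lerDr sqr_ge0.
(* Joint vanishing of both parts gives the hypothesis of [gsum_zeros_bound] for whichever part is
   nonzero somewhere. *)
pose P x m := forall j, (j < m)%N ->
  derive1n j (fRe a c) x = 0 /\ derive1n j (fIm a c) x = 0.
have PN x : zeroset a c x -> P x 1%N by move=> [r i] [|j].
have P0 x : P x 0%N by [].
have [fx|fx] := fx0.
- have [K HK] := gsum_zeros_bound a0 ReM fx.
  apply: (lower_density_le1 P0 PN (q := 3 / a) (K := K)) => n s sn sP.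
  by apply: HK => // x xs j jx; case: (sP x xs j jx).
- have [K HK] := gsum_zeros_bound a0 ImM fx.
  apply: (lower_density_le1 P0 PN (q := 3 / a) (K := K)) => n s sn sP.
  by apply: HK => // x xs j jx; case: (sP x xs j jx).
Qed.
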